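(* Let $G$ be a graph and let $\vec p=(p_e)_{e\in E(G)}\in[0,1]^{E(G)}$. Then the statement $$\forall T\subseteq V(G)\ \forall v,w\in V(G):\ \mathscr B(G,T,\vec p,v,w)\text{ holds}$$ is equivalent to the statement $$\forall H\in\mathbb B(G)\ \forall T\subseteq V(H)\ \forall v,w\in V(H):\ \mathscr B(H,T,(p_e)_{e\in E(H)},v,w)\text{ holds}.$$ In particular, a graph satisfies the weak bunkbed conjecture if and only if all of its biconnected components satisfy the weak bunkbed conjecture, and a graph satisfies the strong bunkbed conjecture if and only if all of its biconnected components satisfy the strong bunkbed conjecture.
   Context: All graphs are finite and simple; an edge between $v$ and $w$ is written $vw=\{v,w\}$. Bunkbed graph: for a graph $G$, $B(G)$ has vertex set $V(G)\times\{0,1\}$; write $v_i=(v,i)$ and, for $e=xy\in E(G)$, $e_i=x_iy_i$. Its edges are the horizontal edges $e_i$ ($e\in E(G)$, $i\in\{0,1\}$) and the posts $v_0v_1$ ($v\in V(G)$). Percolation: for $T\subseteq V(G)$ and $\vec p=(p_e)_{e\in E(G)}\in[0,1]^{E(G)}$, $B^T=B^T(G,\vec p)$ is the random subgraph of $B(G)$ containing all vertices of $B(G)$, in which each horizontal edge $e_i$ is present with probability $p_e$, independently of all other horizontal edges, and each post $v_0v_1$ is deterministically present if and only if $v\in T$. Write $a\overset{B^T}{\longleftrightarrow}b$ if there is a path between $a$ and $b$ in $B^T$. For $v,w\in V(G)$, $\mathscr B(G,T,\vec p,v,w)$ denotes the statement $\mathbb P(v_0\overset{B^T}{\longleftrightarrow}w_0)\ge\mathbb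 P(v_0\overset{B^T}{\longleftrightarrow}w_1)$. $G$ satisfies the strong bunkbed conjecture if $\mathscr B(G,T,\vec p,v,w)$ holds for all $T\subseteq V(G)$, $\vec p\in[0,1]^{E(G)}$, $v,w\in V(G)$. $G$ satisfies the weak bunkbed conjecture if $\mathscr B(G,T,(p)_{e\in E(G)},v,w)$ holds for all $T\subseteq V(G)$, $p\in[0,1]$, $v,w\in V(G)$ (constant edge weights). Blocks: a graph $H$ is biconnected if $|V(H)|\ge2$, $H$ is connected, and $H\setminus x$ (delete $x$ and all incident edges) is connected for every $x\in V(H)$; in particular $K_2$ is biconnected. A biconnected component (block) of $G$ is a subgraph of $G$ that is maximal (with respect to the subgraph relation) among the biconnected subgraphs of $G$. $\mathbb B(G)$ is the set of blocks of $G$. *)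

(* Defs.v *)
From mathcomp Require Import all_boot all_order all_algebra.
From mathcomp Require Import reals.

Set Implicit Arguments.
Unset Strict Implicit.
Unset Printing Implicit Defensive.

Import Order.TTheory GRing.Theory Num.Theory.

Local Open Scope ring_scope.

(* Vertices live in an ambient finite type U, so that a graph
   and its subgraphs are objects of the same type.  An edge vw is the
   two-element set [set v; w]. *)
Record graph (U : finType) := Graph {
  V : {set U};
  E : {set {set U}};
  edgesP : [forall e in E, (e \subset V) && (#|e| == 2)]
}.

Section Graphs.
Context (U : finType).
Implicit Types (G H K : graph U) (F : {set {set U}}) (x a b : U).

Definition subgraph H G : bool := (V H \subset V G) && (E H \subset E G).

Definition adj G : rel U := fun a b => [set a; b] \in E G.

(* Only meant for vertices a, b of G: [connect] is reflexive on all of U. *)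
Definition joined G a b : bool := connect (adj G) a b.

Definition connected G : Prop :=
  forall a b, a \in V G -> b \in V G -> joined G a b.

Lemma del_vertex_edgesP G x :
  [forall e in [set e in E G | x \notin e],
    (e \subset V G :\ x) && (#|e| == 2)].
Proof.
apply/forall_inP => e; rewrite inE => /andP[eG xe].
have /andP[eV ->] := forall_inP (edgesP G) e eG.
by rewrite subsetD1 eV xe.
Qed.

Definition del_vertex G x : graph U := Graph (del_vertex_edgesP G x).

Lemma spanning_edgesP G F :
  [forall e in E G :&: F, (e \subset V G) && (#|e| == 2)].
Proof.
apply/forall_inP => e; rewrite inE => /andP[eG _].
exact: (forall_inP (edgesP G)).
Qed.

Definition spanning G F : graph U := Graph (spanning_edgesP G F).

Definition biconnected H : Prop :=
  [/\ (2 <= #|V H|)%N,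
      connected H
    & forall x, x \in V H -> connected (del_vertex H x)].

Definition block G H : Prop :=
  [/\ biconnected H,
      subgraph H G
    & forall K, biconnected K -> subgraph K G -> subgraph H K -> K = H].

End Graphs.

Section Bunkbed.
Context (U : finType).
Implicit Types (G : graph U) (T e : {set U}).

(* Layer 0 is [false] and layer 1 is [true]. *)
Definition lift_edge e (i : bool) : {set U * bool} := [set (x, i) | x in e].

Definition horizontal G : {set {set U * bool}} :=
  [set lift_edge e i | e in E G, i in [set: bool]].

Definition posts T : {set {set U * bool}} :=
  [set [set (v, false); (v, true)] | v in T].

Lemma bunkbed_edgesP G :
  [forall e in horizontal G :|: posts (V G),
    (e \subset setX (V G) [set: bool]) && (#|e| == 2)].
Proof.
apply/forall_inP => f /setUP[/imset2P[e i eG _ ->]|/imsetP[v vG ->]].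
  have /andP[eV /eqP e2] := forall_inP (edgesP G) e eG.
  rewrite card_imset ?e2 ?eqxx ?andbT; last by move=> x y [].
  by apply/subsetP => _ /imsetP[x xe ->]; rewrite !inE (subsetP eV).
rewrite cards2 xpair_eqE andbF /= andbT.
by apply/subsetP => _ /set2P[] ->; rewrite !inE vG.
Qed.

Definition bunkbed G : graph (U * bool)%type := Graph (bunkbed_edgesP G).

(* B^T for the outcome in which w, a subset of [horizontal G], is the set of
   present horizontal edges. *)
Definition percolated G T (w : {set {set U * bool}}) : graph (U * bool)%type :=
  spanning (bunkbed G) (w :|: posts T).

Context (R : realType).
Implicit Type p : {set U} -> R.

Definition weights G p : Prop := forall e, e \in E G -> 0 <= p e <= 1.

(* The product Bernoulli law on subsets of [horizontal G]; only the values of p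
   on E G matter. *)
Definition outcome_prob G p (w : {set {set U * bool}}) : R :=
  \prod_(e in E G) \prod_(i : bool)
    (if lift_edge e i \in w then p e else 1 - p e).

Definition prob G p (A : pred {set {set U * bool}}) : R :=
  \sum_(w in powerset (horizontal G) | A w) outcome_prob G p w.

Definition prob_joined G T p (a b : U * bool) : R :=
  prob G p (fun w => joined (percolated G T w) a b).

Definition bunkbed_ineq G T p (v w : U) : Prop :=
  prob_joined G T p (v, false) (w, false) >=
  prob_joined G T p (v, false) (w, true).

Definition bunkbed_holds G p : Prop :=
  forall T, T \subset V G -> forall v w, v \in V G -> w \in V G ->
  bunkbed_ineq G T p v w.

End Bunkbed.

Definition strong_bunkbed (R : realType) (U : finType) (G : graph U) : Prop :=
  forall p : {set U} -> R, weights G p -> bunkbed_holds G p.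

Definition weak_bunkbed (R : realType) (U : finType) (G : graph U) : Prop :=
  forall p : R, 0 <= p <= 1 -> bunkbed_holds G (fun=> p).

(* Main.v *)
Require Import Defs.
From mathcomp Require Import all_boot all_order all_algebra.
From mathcomp Require Import reals ring.

Set Implicit Arguments.
Unset Strict Implicit.
Unset Printing Implicit Defensive.

Import Order.TTheory GRing.Theory Num.Theory.

(** A graph on at least two vertices is either its own unique block or a union
    of two proper subgraphs G1, G2 sharing at most a vertex x. The blocks of G are those of G1 together with those of G2, so by
    induction it suffices that the inequalities for G are equivalent to those
    for G1 and G2 together. For v, w in G1, the outcome on G2 matters only
    through whether it joins x_0 to x_1, that is, whether it acts as a post at x;
    so the probability for G is an average of probabilities for G1 with posts T
    or x |: T, and it is the probability for G1 itself when T lies in G1. For v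
    in G1 and w in G2, put gap(v, w) = P(v_0 ~ w_0) - P(v_0 ~ w_1); exchanging the
    layers of G2 gives gap_G(v, w) = gap_G1(v, x) * gap_G2(x, w). *)

(** Reduces each claim that paths cannot leave a set to a check on single edges. *)
Lemma connect_closed (X : finType) (e : rel X) (P : pred X) :
  (forall a b, e a b -> P a -> P b) ->
  forall a b, connect e a b -> P a -> P b.
Proof.
move=> cl a b /connectP[s + ->].
by elim: s a => //= c s IH a /andP[ac cs] Pa; apply: IH cs (cl _ _ ac Pa).
Qed.

(** * Separations of a graph at a vertex, and blocks *)

Section Graphs.
Context (U : finType).
Implicit Types (G H K : graph U) (x a b : U).

Lemma graph_inj G H : V G = V H -> E G = E H -> G = H.
Proof.
case: G H => [VG EG gP] [VH EH hP] /= eV eE.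
by case: _ / eV hP => hP; case: _ / eE hP => hP; rewrite (bool_irrelevance gP hP).
Qed.

Lemma edge_sub G e : e \in E G -> e \subset V G.
Proof. by move=> eG; have /andP[] := forall_inP (edgesP G) e eG. Qed.

Lemma card_edge G e : e \in E G -> #|e| = 2.
Proof. by move=> eG; have /andP[_ /eqP] := forall_inP (edgesP G) e eG. Qed.

Lemma adjV G a b : adj G a b -> (a \in V G) && (b \in V G).
Proof. by move=> /edge_sub; rewrite subUset !sub1set. Qed.

Lemma adj_sym G : symmetric (adj G).
Proof. by move=> a b; rewrite /adj setUC. Qed.

Lemma joined_sym G : symmetric (joined G).
Proof. exact/sym_connect_sym/adj_sym. Qed.

Lemma eq_joined G H : E G = E H -> joined G =2 joined H.
Proof. by move=> eE; apply: eq_connect => a b; rewrite /adj eE. Qed.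

(** Since [joined] is reflexive even off the graph, only distinct endpoints are forced to be
    vertices. *)
Lemma joinedV G a b : joined G a b -> a != b -> (a \in V G) && (b \in V G).
Proof.
have half c d : joined G c d -> c != d -> c \in V G.
  case/connectP => [[|y s]] /= => [_ -> /eqP//|/andP[/adjV/andP[]]//].
move=> ab nab; rewrite (half a b) //= (half b a) 1?joined_sym //.
by rewrite eq_sym.
Qed.

Lemma subgraph_trans G H K : subgraph H G -> subgraph K H -> subgraph K G.
Proof.
move=> /andP[VHG EHG] /andP[VKH EKH].
by rewrite /subgraph (subset_trans VKH VHG) (subset_trans EKH EHG).
Qed.

Lemma subgraph_refl G : subgraph G G.
Proof. by rewrite /subgraph !subxx. Qed.

Lemma subgraph_anti G H : subgraph H G -> subgraph G H -> G = H.
Proof.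
move=> /andP[VHG EHG] /andP[VGH EGH].
by apply: graph_inj; apply/eqP; rewrite eqEsubset ?VGH ?EGH.
Qed.

Lemma induced_edgesP G (A : {set U}) :
  [forall e in [set e in E G | e \subset A],
    (e \subset V G :&: A) && (#|e| == 2)].
Proof.
apply/forall_inP => e; rewrite inE => /andP[eG eA].
by rewrite subsetI eA edge_sub //= (card_edge eG).
Qed.

Definition induced G A : graph U := Graph (induced_edgesP G A).

(** The intersection may be empty, so one notion covers both disconnected graphs and cut
    vertices. *)
Definition separation G x G1 G2 : Prop :=
  [/\ V G = V G1 :|: V G2, E G = E G1 :|: E G2
    & V G1 :&: V G2 \subset [set x]].

Lemma separationC G x G1 G2 : separation G x G1 G2 -> separation G x G2 G1.
Proof. by case=> eV eE s; split; rewrite 1?setUC 1?setIC. Qed.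

Lemma separation_mem G x G1 G2 y :
  separation G x G1 G2 -> y \in V G1 -> y \in V G2 -> y = x.
Proof.
by case=> _ _ /subsetP s y1 y2; apply/set1P/s; rewrite inE y1.
Qed.

(** Source of all disjointness facts: an edge or a block has at least two vertices, so it cannot lie
    on both sides. *)
Lemma separation_card G x G1 G2 (A : {set U}) :
  separation G x G1 G2 -> A \subset V G1 -> A \subset V G2 -> #|A| <= 1.
Proof.
case=> _ _ s A1 A2; rewrite -(cards1 x); apply/subset_leq_card/(subset_trans _ s).
by rewrite subsetI A1.
Qed.

Lemma separation_edge G x G1 G2 e :
  separation G x G1 G2 -> e \in E G1 -> e \notin E G2.
Proof.
move=> sep e1; apply/negP => e2.
by have := separation_card sep (edge_sub e1) (edge_sub e2); rewrite (card_edge e1).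
Qed.

Lemma separation_subgraph G x G1 G2 : separation G x G1 G2 -> subgraph G1 G.
Proof. by case=> eV eE _; rewrite /subgraph eV eE !subsetUl. Qed.

(** When x is not a vertex of K, deleting it removes no edge and connectedness of K suffices. *)
Lemma biconnected_joined K x a b : biconnected K ->
  a \in V K -> b \in V K -> a != x -> b != x -> joined (del_vertex K x) a b.
Proof.
move=> [_ cK dK] aK bK ax bx; have [xK|xK] := boolP (x \in V K).
  by apply: dK; rewrite // !inE ?ax ?bx.
rewrite (@eq_joined _ K) ?cK //; apply/setP => e; rewrite inE.
by case: (boolP (e \in E K)) => //= /edge_sub/subsetP s; apply: contra xK => /s.
Qed.

(** If K had a vertex a outside G2 and a vertex b outside G1, a path from a to b avoiding x could
    never leave G1. *)
Lemma biconnected_sub G x G1 G2 K : separation G x G1 G2 ->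
  biconnected K -> subgraph K G -> subgraph K G1 \/ subgraph K G2.
Proof.
move=> sep bK /andP[KV KE].
have edges G1' G2' : separation G x G1' G2' -> V K \subset V G1' -> subgraph K G1'.
  move=> sep'; rewrite /subgraph => KV1; rewrite KV1; apply/subsetP => e eK.
  have [_ eE _] := sep'; have := subsetP KE e eK.
  rewrite eE inE => /orP[//|e2].
  have := separation_card sep' (subset_trans (edge_sub eK) KV1) (edge_sub e2).
  by rewrite (card_edge eK).
have [K1|/subsetPn[b bK1 b1]] := boolP (V K \subset V G1); first by left; apply: edges sep _.
have [K2|/subsetPn[a aK a2]] := boolP (V K \subset V G2).
  by right; apply: edges (separationC sep) _.
have [eV eE _] := sep; exfalso.
have inG c : c \in V K -> (c \in V G1) || (c \in V G2).
  by move=> /(subsetP KV); rewrite eV inE.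
have a1 : a \in V G1 by have := inG a aK; rewrite (negPf a2) orbF.
have step c d : adj K c d -> c \in V G1 -> c \notin V G2 -> d \in V G1.
  move=> /(subsetP KE); rewrite eE inE => /orP[/adjV/andP[]//|/adjV/andP[->]//].
(* If x is not on both sides, the sides are disjoint, and connectedness of K already gives the
   contradiction. *)
have [x12|x12] := boolP ((x \in V G1) && (x \in V G2)); last first.
  have disj c : c \in V G1 -> c \notin V G2.
    move=> c1; apply/negP => c2; have cx := separation_mem sep c1 c2.
    by rewrite -cx c1 c2 in x12.
  have [_ cK _] := bK.
  have cl c d : adj K c d -> c \in V G1 -> d \in V G1.
    by move=> cd c1; apply: step cd c1 (disj _ c1).
  by case/negP: b1; apply: (connect_closed (P := mem (V G1)) cl) (cK a b aK bK1) a1.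
have /andP[x1 x2] := x12.
have ax : a != x by apply: contraNneq a2 => ->.
have bx : b != x by apply: contraNneq b1 => ->.
have cl c d : adj (del_vertex K x) c d -> c \in V G1 -> d \in V G1.
  rewrite /adj !inE => /andP[cd /norP[xc _]] c1; apply: (step _ _ cd c1).
  by apply/negP => c2; rewrite (separation_mem sep c1 c2) eqxx in xc.
case/negP: b1.
exact: (connect_closed (P := mem (V G1)) cl) (biconnected_joined bK aK bK1 ax bx) a1.
Qed.

(** A biconnected K above H lies on one side. It cannot be G2, for then the two or more vertices of
    H would lie on both sides. *)
Lemma block_separation G x G1 G2 H : separation G x G1 G2 ->
  block G1 H -> block G H.
Proof.
move=> sep [bH HG1 maxH]; have sub1 := separation_subgraph sep.
split=> //; first exact: subgraph_trans HG1.
move=> K bK KG HK; apply: maxH => //.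
case: (biconnected_sub sep bK KG) => // /andP[KG2 _].
have [c2 _ _] := bH; have /andP[HV _] := HK; have /andP[HV1 _] := HG1.
by have := separation_card sep HV1 (subset_trans HV KG2); rewrite leqNgt c2.
Qed.

Lemma separation_block G x G1 G2 H : separation G x G1 G2 ->
  block G H -> block G1 H \/ block G2 H.
Proof.
move=> sep [bH HG maxH]; have sub1 := separation_subgraph sep.
have sub2 := separation_subgraph (separationC sep).
by case: (biconnected_sub sep bH HG) => HGi; [left|right]; split=> // K bK KG;
  apply: maxH => //; [apply: subgraph_trans KG|apply: subgraph_trans KG].
Qed.

(** The closure condition rules out edges between the part of A off B and the part of B off A, so
    every edge is induced by A or by B. The vertices a and b witness that both sides are smaller
    than G. *)
Lemma separation_induced G x (A B : {set U}) a b :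
    V G \subset A :|: B -> A :&: B \subset [set x] ->
    (forall c d, adj G c d -> c \in A -> c \notin B -> d \in A) ->
    a \in V G -> b \in V G -> a \notin B -> b \notin A ->
  exists G1 G2, [/\ separation G x G1 G2, #|V G1| < #|V G| & #|V G2| < #|V G|].
Proof.
move=> sub AB cl aG bG aB bA; exists (induced G A), (induced G B).
have smaller c (C : {set U}) : c \in V G -> c \notin C -> #|V (induced G C)| < #|V G|.
  move=> cG cC; apply: proper_card; rewrite properE subsetIl /=.
  by apply/subsetPn; exists c; rewrite // inE negb_and cC orbT.
split; [|exact: smaller bA|exact: smaller aB]; split=> /=.
- by rewrite -setIUr (setIidPl sub).
- apply/setP => e; rewrite !inE -andb_orr; case: (boolP (e \in E G)) => //= eG.
  symmetry; apply/orP.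
  have /eqP/cards2P[c [d [_ e_cd]]] := card_edge eG.
  have cd : adj G c d by rewrite /adj -e_cd.
  have dc : adj G d c by rewrite adj_sym.
  have /andP[/(subsetP sub) + /(subsetP sub)] := adjV cd.
  rewrite e_cd !subUset !sub1set !inE.
  have := cl _ _ cd; have := cl _ _ dc.
  case: (c \in A); case: (c \in B); case: (d \in A); case: (d \in B) => //= h1 h2 _ _;
    by [left|right|have := h1 isT isT|have := h2 isT isT].
- by rewrite setIACA; apply: subset_trans AB; apply: subsetIr.
Qed.

(** A disconnected G splits into a component and its complement. Otherwise some x disconnects G: one
    side is a component C of G minus x together with x, the other is the complement of C. *)
Lemma biconnected_or_separation G : 1 < #|V G| -> biconnected G \/
  exists x G1 G2, [/\ separation G x G1 G2, #|V G1| < #|V G| & #|V G2| < #|V G|].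
Proof.
move=> G_large.
have [/forall_inP cG|] := boolP [forall a in V G, forall b in V G, joined G a b]; last first.
  case/forall_inPn => a aG /forall_inPn[b bG nab].
  (* Any vertex can play the role of x here, because [A] and its complement share none. *)
  pose A := [set c | joined G a c]; right; exists a.
  apply: (@separation_induced _ _ A (~: A) a b) => //.
  - by rewrite setUCr subsetT.
  - by rewrite setICr sub0set.
  - by move=> c d cd; rewrite !inE => ac _; apply: connect_trans ac (connect1 cd).
  - by rewrite !inE negbK; apply: connect0.
  - by rewrite inE.
have [/forall_inP dG|] := boolP [forall x in V G, forall a in V G :\ x,
    forall b in V G :\ x, joined (del_vertex G x) a b].
  left; split=> // [a b aG bG|x xG a b aG bG].
    by have /forall_inP := cG a aG; apply.
  by have /forall_inP/(_ a aG)/forall_inP := dG x xG; apply.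
case/forall_inPn => x xG /forall_inPn[a aG /forall_inPn[b bG nab]].
move: aG bG; rewrite !inE => /andP[ax aG] /andP[bx bG].
pose C := [set c | joined (del_vertex G x) a c]; right; exists x.
have xC : x \notin C.
  rewrite inE; apply/negP => ax'; have := joinedV ax' ax.
  by rewrite !inE eqxx andbF.
apply: (@separation_induced _ _ (x |: C) (~: C) a b) => //.
- by rewrite -setUA setUCr setUT subsetT.
- by apply/subsetP => c; rewrite !inE; case: (c == x) => //= /andP[->].
- move=> c d cd; rewrite !inE negbK => _ ac.
  have [//|dx] := eqVneq d x; apply: (connect_trans ac (connect1 _)).
  rewrite /adj !inE negb_or !(eq_sym x) dx andbT; apply/andP; split=> //.
  by apply: contraNneq xC => cx; rewrite inE; rewrite cx in ac.
- by rewrite !inE negbK; apply: connect0.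
- by rewrite !inE (negPf bx).
Qed.

End Graphs.

(** * Connections in the percolated bunkbed graph *)

Section Percolation.
Context (U : finType).
Implicit Types (G : graph U) (T e : {set U}) (x : U) (a b : U * bool).
Implicit Types (f : {set U * bool}) (w : {set {set U * bool}}).

Lemma fst_lift_edge e i : fst @: lift_edge e i = e.
Proof. by rewrite -imset_comp imset_id. Qed.

Lemma lift_edge_inj e e' i i' : lift_edge e i = lift_edge e' i' -> e = e'.
Proof. by move=> /(congr1 (fun f => fst @: f)); rewrite !fst_lift_edge. Qed.

(** An edge is nonempty; the empty set would have the same lift in both layers. *)
Lemma lift_edge_layer G e i i' : e \in E G -> lift_edge e i = lift_edge e i' -> i = i'.
Proof.
move=> eG eq_ii'; have /card_gt0P[y ye] : 0 < #|e| by rewrite (card_edge eG).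
have : (y, i) \in lift_edge e i' by rewrite -eq_ii' imset_f.
by case/imsetP => z _ [].
Qed.

Lemma mem_horizontal G e i : (lift_edge e i \in horizontal G) = (e \in E G).
Proof.
apply/imset2P/idP => [[e' i' eG _ /lift_edge_inj->//]|eG].
by exists e i.
Qed.

Lemma horizontalP G f :
  reflect (exists2 e, e \in E G & exists i, f = lift_edge e i) (f \in horizontal G).
Proof.
apply: (iffP imset2P) => [[e i eG _ ->]|[e eG [i ->]]]; last by exists e i.
by exists e => //; exists i.
Qed.

Lemma mem_posts T a b :
  ([set a; b] \in posts T) = [&& a.1 == b.1, a.2 != b.2 & a.1 \in T].
Proof.
apply/imsetP/and3P => [[v vT ab]|[]].
  have : (v, false) \in [set a; b] by rewrite ab set21.
  have : (v, true) \in [set a; b] by rewrite ab set22.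
  by case/set2P => <-; case/set2P => // <-; split=> /=.
case: a b => [v i] [v' i'] /= /eqP <- ii' vT; exists v => //.
by case: i i' ii' => [] [] // _; rewrite setUC.
Qed.

(** A post projects to a single vertex, a horizontal edge to two. *)
Lemma posts_horizontal G T f : f \in posts T -> f \notin horizontal G.
Proof.
case/imsetP => v _ ->; apply/negP => /horizontalP[e eG [i /(congr1 (fun f => fst @: f))]].
rewrite fst_lift_edge imsetU1 imset_set1 /= setUid => ve.
by have := card_edge eG; rewrite -ve cards1.
Qed.

Lemma adj_percolated G T w a b : w \subset horizontal G ->
  adj (percolated G T w) a b =
  ([set a; b] \in w) || [&& a.1 == b.1, a.2 != b.2, a.1 \in V G & a.1 \in T].
Proof.
move=> /subsetP wG; rewrite /adj inE !in_setU /=.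
have := wG [set a; b]; case: (_ \in w) => [->//|_] /=.
have := @posts_horizontal G T [set a; b]; rewrite !mem_posts.
case: (a.1 == b.1) => /=; last by rewrite andbF.
case: (a.2 != b.2) => /=; last by rewrite andbF.
by case: (a.1 \in T); rewrite ?andbF //= => /(_ isT)/negPf->.
Qed.

Lemma adj_percolatedV G T w a b :
  adj (percolated G T w) a b -> (a.1 \in V G) && (b.1 \in V G).
Proof.
rewrite /adj inE => /andP[/edge_sub + _]; rewrite /= subUset !sub1set.
by case: a b => [? ?] [? ?]; rewrite !inE /= !andbT.
Qed.

(** Posts outside the graph have no effect. This allows the same T to be used for G and for both
    sides of a separation. *)
Lemma joined_percolatedI G T w :
  joined (percolated G (V G :&: T) w) =2 joined (percolated G T w).
Proof.
apply: eq_joined; apply/setP => f; rewrite /= !inE.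
case: (boolP (f \in w)) => //= _.
apply/andP/andP => -[fG fT]; split=> //.
  by case/imsetP: fT => v; rewrite inE => /andP[_ vT] ->; apply/imsetP; exists v.
case/orP: fG => [fG|/imsetP[v vG fv]].
  by have := posts_horizontal G fT; rewrite fG.
by rewrite fv mem_posts inE vG; move: fT; rewrite fv mem_posts.
Qed.

Lemma joined_percolatedV G T w a b : joined (percolated G T w) a b -> a != b ->
  (a.1 \in V G) && (b.1 \in V G).
Proof.
by move=> ab /(joinedV ab); case: a b {ab} => [? ?] [? ?]; rewrite !inE /= !andbT.
Qed.

Lemma separation_horizontal G x G1 G2 : separation G x G1 G2 ->
  horizontal G = horizontal G1 :|: horizontal G2.
Proof.
move=> [_ eE _]; apply/setP => f; rewrite inE; apply/horizontalP/orP.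
  by case=> e + [i ->]; rewrite eE inE !mem_horizontal => /orP[]; [left|right].
by case=> /horizontalP[e eG [i ->]]; exists e; rewrite ?eE ?inE ?eG ?orbT //; exists i.
Qed.

Lemma separation_disjoint G x G1 G2 f : separation G x G1 G2 ->
  f \in horizontal G1 -> f \notin horizontal G2.
Proof.
move=> sep /horizontalP[e e1 [i ->]]; rewrite mem_horizontal.
exact: separation_edge sep e1.
Qed.

Lemma adj_percolated_separation G x G1 G2 T w1 w2 a b : separation G x G1 G2 ->
  w1 \subset horizontal G1 -> w2 \subset horizontal G2 ->
  adj (percolated G T (w1 :|: w2)) a b =
  adj (percolated G1 T w1) a b || adj (percolated G2 T w2) a b.
Proof.
move=> sep w1G w2G; rewrite !adj_percolated //; last first.
  by rewrite (separation_horizontal sep) setUSS.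
have [-> _ _] := sep; rewrite !inE.
case: (_ \in w1) => //=; case: (_ \in w2); rewrite /= ?orbT //.
by case: (a.1 == b.1); case: (a.2 != b.2); rewrite //= andb_orl.
Qed.

(** The effect of the outcome w on G, as felt by a graph that meets G only in x. *)
Definition attached_posts G x T w : {set U} :=
  if joined (percolated G T w) (x, false) (x, true) then x |: T else T.

(* Seen from one side, the other side can only act as a post at x. *)
Lemma joined_separation G x G1 G2 T w1 w2 a b : separation G x G1 G2 ->
  w1 \subset horizontal G1 -> w2 \subset horizontal G2 -> a.1 \in V G1 ->
  joined (percolated G T (w1 :|: w2)) a b =
  let B1 := percolated G1 (attached_posts G2 x T w2) w1 in
  if b.1 \in V G1 then joined B1 a b
  else [exists i, joined B1 a (x, i) && joined (percolated G2 T w2) (x, i) b].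
Proof.
move=> sep w1G w2G a1 /=; set B1 := percolated G1 _ _.
set B := percolated G _ _; set B2 := percolated G2 T w2.
have adjB c d : adj B c d = adj (percolated G1 T w1) c d || adj B2 c d.
  exact: adj_percolated_separation sep w1G w2G.
have B2_B c d : joined B2 c d -> joined B c d.
  by apply: connect_sub => {}c {}d cd; apply: connect1; rewrite adjB cd orbT.
have B1_step c d : adj (percolated G1 T w1) c d -> adj B1 c d.
  rewrite !adj_percolated // /attached_posts; case: ifP => // _.
  by rewrite !inE => /orP[->//|/and4P[-> -> -> ->]]; rewrite !orbT.
(* An excursion into G2 between the copies of x can be replaced by the attached post. *)
have link i j : x \in V G1 -> joined B2 (x, i) (x, j) -> joined B1 (x, i) (x, j).
  move=> x1; have [-> _|ij xx] := eqVneq i j; first exact: connect0.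
  apply: connect1; rewrite adj_percolated // /attached_posts.
  suff -> : joined (percolated G2 T w2) (x, false) (x, true).
    by rewrite !inE /= eqxx ij x1 orbT.
  by case: i j xx ij => [] [] //; rewrite joined_sym.
have B1_B c d : joined B1 c d -> joined B c d.
  apply: connect_sub => {}c {}d; rewrite adj_percolated // /attached_posts.
  case: ifP => [xx|_]; last first.
    by rewrite -adj_percolated // => cd; apply: connect1; rewrite adjB cd.
  rewrite !inE => /orP[cd|].
    by apply: connect1; rewrite adjB adj_percolated ?cd.
  case/and4P => cd1 cd2 c1 /orP[/eqP cx|cT]; last first.
    by apply: connect1; rewrite adjB adj_percolated // cd1 cd2 c1 cT !orbT.
  (* Conversely, the attached post at x stands for a path through G2. *)
  have := B2_B _ _ xx; case: c d cx cd1 cd2 {c1} => [v i] [v' i'] /= -> /eqP <-.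
  by case: i i' => [] [] // _; rewrite joined_sym.
(* [Z] is the claimed set of points reachable from a; it remains to see that edges of either side do
   not leave it. *)
pose Z := [pred c | if c.1 \in V G1 then joined B1 a c
  else [exists i, joined B1 a (x, i) && joined B2 (x, i) c]].
apply/idP/idP => [ab|]; last first.
  case: ifP => _; first exact: B1_B.
  case/existsP => i /andP[ax xb]; exact: connect_trans (B1_B _ _ ax) (B2_B _ _ xb).
suff cl c d : adj B c d -> Z c -> Z d.
  by apply: (connect_closed cl ab); rewrite /= a1; apply: connect0.
rewrite adjB => /orP[cd|cd].
  have /andP[c1 d1] := adj_percolatedV cd; rewrite /= c1 d1 => ac.
  exact: connect_trans ac (connect1 (B1_step _ _ cd)).
have /andP[c2 d2] := adj_percolatedV cd.
have layer (y : U * bool) : y.1 \in V G1 -> y.1 \in V G2 -> y = (x, y.2).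
  by move=> y1 y2; rewrite -(separation_mem sep y1 y2); case: y {y1 y2}.
rewrite /=; case: ifP => c1; case: ifP => d1.
- move=> ac; apply: connect_trans ac _; have x1 := c1.
  rewrite (separation_mem sep c1 c2) in x1.
  have := connect1 cd; rewrite (layer c) // (layer d) //; exact: link.
- move=> ac; apply/existsP; exists c.2; rewrite -(layer c) // ac /=.
  exact: connect1 cd.
- case/existsP => i /andP[ax xc]; apply: connect_trans ax _.
  have x1 := d1; rewrite (separation_mem sep d1 d2) in x1.
  rewrite (layer d) //; apply: link => //; rewrite -(layer d) //.
  exact: connect_trans xc (connect1 cd).
- case/existsP => i /andP[ax xc]; apply/existsP; exists i; rewrite ax /=.
  exact: connect_trans xc (connect1 cd).
Qed.

(** * Exchange of the two layers *)

Definition swap_layer a : U * bool := (a.1, ~~ a.2).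

Definition swap_layers w := [set f : {set U * bool} | swap_layer @: f \in w].

Lemma swap_edgeK : involutive (fun f : {set U * bool} => swap_layer @: f).
Proof.
move=> f; rewrite -imset_comp -[RHS]imset_id; apply: eq_imset => -[v i].
by rewrite /swap_layer /= negbK.
Qed.

Lemma swap_layersK : involutive swap_layers.
Proof. by move=> w; apply/setP => f; rewrite !inE swap_edgeK. Qed.

Lemma swap_lift_edge e i : swap_layer @: lift_edge e i = lift_edge e (~~ i).
Proof. by rewrite -imset_comp. Qed.

Lemma swap_layers_horizontal G w :
  (swap_layers w \subset horizontal G) = (w \subset horizontal G).
Proof.
suff half w' : w' \subset horizontal G -> swap_layers w' \subset horizontal G.
  by apply/idP/idP => /half //; rewrite swap_layersK.
move=> /subsetP wG; apply/subsetP => f; rewrite inE => /wG.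
case/horizontalP => e eG [i fe].
by rewrite -[f]swap_edgeK fe swap_lift_edge mem_horizontal.
Qed.

(** Posts are invariant under the exchange of layers, so an edge of one percolated graph is mapped
    to an edge of the other. Since the exchange is an involution, one implication is enough. *)
Lemma joined_swap_layers G T w u v i j : w \subset horizontal G ->
  joined (percolated G T (swap_layers w)) (u, i) (v, j) =
  joined (percolated G T w) (u, ~~ i) (v, ~~ j).
Proof.
suff half w' u' v' i' j' : w' \subset horizontal G ->
    joined (percolated G T (swap_layers w')) (u', i') (v', j') ->
    joined (percolated G T w') (u', ~~ i') (v', ~~ j').
  move=> wG; apply/idP/idP => [/half->//|uv].
  rewrite -[i]negbK -[j]negbK; apply: half; first by rewrite swap_layers_horizontal.
  by rewrite swap_layersK.
move=> wG uv; pose Z c := joined (percolated G T w') (u', ~~ i') (swap_layer c).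
apply: (connect_closed (P := Z) _ uv); last exact: connect0.
move=> c d cd uc; apply: connect_trans uc (connect1 _); move: cd.
rewrite !adj_percolated ?swap_layers_horizontal // inE imsetU1 imset_set1 /=.
by rewrite (inj_eq negb_inj).
Qed.

End Percolation.

(** * Expectations under the product law *)

Section Expectation.
Local Open Scope ring_scope.
Context (R : realType) (U : finType).
Implicit Types (G : graph U) (T : {set U}) (x v : U) (p : {set U} -> R).
Implicit Types (w : {set {set U * bool}}) (X Y : {set {set U * bool}} -> R).

Definition expect G p X : R :=
  \sum_(w in powerset (horizontal G)) outcome_prob G p w * X w.

Lemma prob_joinedE G T p a b :
  prob_joined G T p a b = expect G p (fun w => (joined (percolated G T w) a b)%:R).
Proof.
rewrite /prob_joined /prob /expect big_mkcondr; apply: eq_bigr => w _.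
by case: joined; rewrite (mulr1, mulr0).
Qed.

Lemma eq_expect G p X Y :
  (forall w, w \subset horizontal G -> X w = Y w) -> expect G p X = expect G p Y.
Proof. by rewrite /expect => XY; apply: eq_bigr => w; rewrite powersetE => /XY->. Qed.

Lemma outcome_prob_ge0 G p w : weights G p -> 0 <= outcome_prob G p w.
Proof.
move=> pG; apply: prodr_ge0 => e /pG/andP[p0 p1]; apply: prodr_ge0 => i _.
by case: ifP; rewrite ?subr_ge0.
Qed.

Lemma ler_expect G p X Y : weights G p ->
  (forall w, w \subset horizontal G -> X w <= Y w) -> expect G p X <= expect G p Y.
Proof.
move=> pG XY; apply: ler_sum => w; rewrite powersetE => /XY.
exact/ler_wpM2l/outcome_prob_ge0.
Qed.

Lemma expectB G p X Y : expect G p (fun w => X w - Y w) = expect G p X - expect G p Y.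
Proof. by rewrite /expect -sumrB; apply: eq_bigr => w _; rewrite mulrBr. Qed.

Lemma expectD G p X Y : expect G p (fun w => X w + Y w) = expect G p X + expect G p Y.
Proof. by rewrite /expect -big_split; apply: eq_bigr => w _; rewrite mulrDr. Qed.

Lemma expectZ G p c X : expect G p (fun w => c * X w) = c * expect G p X.
Proof. by rewrite /expect mulr_sumr; apply: eq_bigr => w _; rewrite mulrCA. Qed.

Lemma horizontal_imset G : horizontal G =
  [set lift_edge u.1 u.2 | u in [set u : {set U} * bool | u.1 \in E G]].
Proof.
apply/setP => f; apply/horizontalP/imsetP => [[e eG [i ->]]|[[e i]]].
  by exists (e, i); rewrite ?inE.
by rewrite inE => eG ->; exists e => //; exists i.
Qed.

(** Turns the double product into a single one over lifted edges; the projection [fst @: f] recovers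
    the edge of G. *)
Lemma outcome_probE G p w : outcome_prob G p w =
  \prod_(f in horizontal G) (if f \in w then p (fst @: f) else 1 - p (fst @: f)).
Proof.
rewrite horizontal_imset big_imset => [|[e i] [e' i']]; last first.
  rewrite !inE /= => eG _ eq_l; have ee := lift_edge_inj eq_l.
  by rewrite -ee in eq_l *; rewrite (lift_edge_layer eG eq_l).
rewrite /outcome_prob pair_big; apply: eq_big => [u|[e i] _]; first by rewrite inE andbT.
by rewrite fst_lift_edge.
Qed.

(** The total mass is one: expand the product of the factors q + (1 - q) over all horizontal
    edges. *)
Lemma expect_cst G p c : expect G p (fun=> c) = c.
Proof.
rewrite /expect -mulr_suml -[RHS]mul1r; congr (_ * c).
pose h := horizontal G; pose q (f : {set U * bool}) := p (fst @: f).
(* Off the horizontal edges the values 0 and 1 kill every term of the expansion indexed by a set not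
   contained in [h] and leave the other terms unchanged. *)
pose F f := if f \in h then q f else 0; pose F' f := if f \in h then 1 - q f else 1.
have : \prod_f (F f + F' f) = 1.
  by apply: big1 => f _; rewrite /F /F'; case: ifP => _; rewrite ?add0r // addrC subrK.
rewrite bigA_distr => <-; symmetry.
rewrite (bigID (mem (powerset h))) /= [X in _ + X]big1 ?addr0 => [|J].
  apply: eq_bigr => J; rewrite powersetE => /subsetP Jh.
  rewrite outcome_probE [LHS](bigID (mem h)) /= [X in _ * X]big1 ?mulr1 => [|f fh].
    by apply: eq_bigr => f fh; rewrite /F /F' fh.
  rewrite /F /F' (negPf fh); case: ifP => // /Jh; by rewrite (negPf fh).
rewrite powersetE => /subsetPn[f fJ fh].
by rewrite (bigD1 f) //= fJ /F (negPf fh) mul0r.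
Qed.

(** Both lifts of an edge carry the same weight, so the law is invariant under the exchange. *)
Lemma expect_swap_layers G p X : expect G p X = expect G p (fun w => X (swap_layers w)).
Proof.
rewrite /expect (reindex_inj (inv_inj (@swap_layersK U))).
apply: eq_big => w; first by rewrite !powersetE swap_layers_horizontal.
move=> _; congr (_ * _); apply: eq_bigr => e _.
by rewrite (reindex_inj negb_inj); apply: eq_bigr => i _; rewrite inE swap_lift_edge negbK.
Qed.

Lemma outcome_prob_separation G x G1 G2 p w1 w2 : separation G x G1 G2 ->
  w1 \subset horizontal G1 -> w2 \subset horizontal G2 ->
  outcome_prob G p (w1 :|: w2) = outcome_prob G1 p w1 * outcome_prob G2 p w2.
Proof.
move=> sep /subsetP w1G /subsetP w2G; rewrite /outcome_prob; have [_ -> _] := sep.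
rewrite (eq_bigl [predU E G1 & E G2]) => [|e]; last by rewrite !inE.
rewrite bigU /=; last first.
  rewrite disjoint_subset; apply/subsetP => e; exact: separation_edge sep.
congr (_ * _); apply: eq_bigr => e eG; apply: eq_bigr => i _; rewrite inE.
  have -> : (lift_edge e i \in w2) = false; last by rewrite orbF.
  by apply: contraNF (separation_edge sep eG) => /w2G; rewrite mem_horizontal.
have -> // : (lift_edge e i \in w1) = false.
by apply: contraNF (separation_edge (separationC sep) eG) => /w1G; rewrite mem_horizontal.
Qed.

(** Independence of the two sides: an outcome on G is uniquely the union of its traces on them, and
    its probability factors. *)
Lemma expect_separation G x G1 G2 p X : separation G x G1 G2 ->
  expect G p X = expect G1 p (fun w1 => expect G2 p (fun w2 => X (w1 :|: w2))).
Proof.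
move=> sep; have hE := separation_horizontal sep.
transitivity (\sum_(w1 in powerset (horizontal G1)) \sum_(w2 in powerset (horizontal G2))
    outcome_prob G p (w1 :|: w2) * X (w1 :|: w2)); last first.
  apply: eq_bigr => w1; rewrite powersetE => w1G; rewrite mulr_sumr.
  apply: eq_bigr => w2; rewrite powersetE => w2G.
  by rewrite (outcome_prob_separation _ sep) ?mulrA.
rewrite pair_big /expect.
rewrite (reindex_onto (fun u => u.1 :|: u.2)
  (fun w => (w :&: horizontal G1, w :&: horizontal G2))) /=; last first.
  by move=> w; rewrite powersetE hE => /setIidPl wG; rewrite -setIUr.
apply: eq_bigl => -[w1 w2] /=; rewrite !powersetE hE.
have disj w' G' G'' : separation G x G' G'' -> w' \subset horizontal G' ->
    w' :&: horizontal G'' = set0.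
  move=> sep' /subsetP w'G; apply/setP => f; rewrite !inE; apply/negP.
  by case/andP => /w'G/(separation_disjoint sep')/negPf->.
apply/andP/andP => [[_ /eqP[<- <-]]|[w1G w2G]]; first by rewrite !subsetIr.
split; first exact: setUSS.
rewrite !setIUl (setIidPl w1G) (setIidPl w2G) (disj _ _ _ sep w1G).
by rewrite (disj _ _ _ (separationC sep) w2G) setU0 set0U.
Qed.

(** * Connection probabilities in a separated graph *)

Lemma prob_joined_sym G T p a b : prob_joined G T p a b = prob_joined G T p b a.
Proof. by rewrite !prob_joinedE; apply: eq_expect => w _; rewrite joined_sym. Qed.

Lemma prob_joined_swap_layers G T p u v i j :
  prob_joined G T p (u, i) (v, j) = prob_joined G T p (u, ~~ i) (v, ~~ j).
Proof.
rewrite !prob_joinedE expect_swap_layers; apply: eq_expect => w wG /=.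
by rewrite joined_swap_layers.
Qed.

Lemma prob_joined_side G x G1 G2 T p a b : separation G x G1 G2 ->
  a.1 \in V G1 -> b.1 \in V G1 ->
  prob_joined G T p a b =
  expect G2 p (fun w => prob_joined G1 (attached_posts G2 x T w) p a b).
Proof.
move=> sep a1 b1; rewrite prob_joinedE (expect_separation _ _ (separationC sep)).
apply: eq_expect => w2 w2G; rewrite prob_joinedE; apply: eq_expect => w1 w1G.
by rewrite setUC (joined_separation _ _ sep) //= b1.
Qed.

(** Condition on the outcome on G1. If it joins x_0 to x_1, exchanging the layers of G2 makes the
    contribution to the gap vanish. Otherwise at most one copy of x is joined to v_0, and the
    conditional gap is the gap of G2 from x to u, with sign plus for x_0 and minus for x_1, or zero
    if neither copy is joined. *)
Lemma prob_joined_across G x G1 G2 T p v u : separation G x G1 G2 ->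
  v \notin V G2 -> u \in V G2 ->
  let gap G v u := prob_joined G T p (v, false) (u, false)
                   - prob_joined G T p (v, false) (u, true) in
  gap G v u = gap G1 v x * gap G2 x u.
Proof.
move=> sep v2 u2 gap.
pose a i w := joined (percolated G1 T w) (x, i) (v, false).
have -> : gap G1 v x = expect G1 p (fun w => (a false w)%:R - (a true w)%:R).
  by rewrite expectB /gap !(prob_joined_sym _ _ _ (v, false)) !prob_joinedE.
rewrite mulrC -expectZ /gap !(prob_joined_sym _ _ _ (v, false)) !prob_joinedE.
rewrite !(expect_separation _ _ sep) -expectB; apply: eq_expect => w1 w1G.
pose c i j w := joined (percolated G2 (attached_posts G1 x T w1) w) (u, j) (x, i).
(* A path from u_j to v_0 must pass through a copy of x. It is read from u so that G2 is the side on
   which G1 acts as a post. *)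
pose F j w := (a true w1 && c true j w) || (a false w1 && c false j w).
have joinedE j : expect G2 p (fun w2 =>
      (joined (percolated G T (w1 :|: w2)) (u, j) (v, false))%:R) =
    expect G2 p (fun w => (F j w)%:R).
  apply: eq_expect => w2 w2G.
  rewrite setUC (joined_separation _ _ (separationC sep)) //= (negPf v2).
  congr (nat_of_bool _)%:R; apply/existsP/orP => [[[] /andP[? ?]]|[]/andP[? ?]].
  - by left; apply/andP.
  - by right; apply/andP.
  - by exists true; apply/andP.
  - by exists false; apply/andP.
rewrite !joinedE.
have [xx|nxx] := boolP (joined (percolated G1 T w1) (x, false) (x, true)).
  have aE : a true w1 = a false w1.
    apply/idP/idP; first exact: connect_trans.
    by apply: connect_trans; rewrite -/(joined _ _ _) joined_sym.
  (* Here [F] only asks whether u_j reaches some copy of x, a condition whose probability does not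
     depend on the layer j. *)
  rewrite /F aE subrr mulr0 expect_swap_layers; apply/eqP; rewrite subr_eq0; apply/eqP.
  apply: eq_expect => w wG.
  by rewrite /c !joined_swap_layers // -!andb_orr orbC.
(* Exclusivity makes the indicator of the disjunction a sum of two indicators. *)
have excl : ~~ (a true w1 && a false w1).
  apply: contra nxx => /andP[xt xf]; rewrite /a joined_sym in xt.
  exact: connect_trans xf xt.
have cE i j : expect G2 p (fun w => (c i j w)%:R) = prob_joined G2 T p (x, i) (u, j).
  rewrite prob_joined_sym prob_joinedE; apply: eq_expect => w _.
  by rewrite /c /attached_posts ifN.
have FE j : expect G2 p (fun w => (F j w)%:R) =
    (a true w1)%:R * prob_joined G2 T p (x, true) (u, j)
    + (a false w1)%:R * prob_joined G2 T p (x, false) (u, j).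
  rewrite -!cE -!expectZ -expectD; apply: eq_expect => w _; rewrite /F.
  case: (a true w1) (a false w1) excl => [] [] //= _;
    by rewrite ?orbF !(mul1r, mul0r, add0r, addr0).
rewrite !FE !(prob_joined_swap_layers _ _ _ _ _ true) /= -!prob_joinedE.
ring.
Qed.

Lemma weights_separation G x G1 G2 p : separation G x G1 G2 ->
  weights G p -> weights G1 p.
Proof. by move=> [_ eE _] pG e e1; apply: pG; rewrite eE inE e1. Qed.

(** * Transfer of the inequalities between a graph and its parts *)

Lemma bunkbed_ineq_refl G T p v : weights G p -> bunkbed_ineq G T p v v.
Proof.
move=> pG; rewrite /bunkbed_ineq !prob_joinedE; apply: ler_expect => // w _.
by rewrite [X in _ <= (X : bool)%:R]connect0 ler_nat leq_b1.
Qed.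

(** Needed because x, or some posts of T, may lie outside a given side. For distinct v and u not
    both in G, both probabilities are zero. *)
Lemma bunkbed_ineqW G T p v u : weights G p -> bunkbed_holds G p ->
  bunkbed_ineq G T p v u.
Proof.
move=> pG holds.
have [<-|vu] := eqVneq v u; first exact: bunkbed_ineq_refl.
rewrite /bunkbed_ineq.
have [/andP[vG uG]|nG] := boolP ((v \in V G) && (u \in V G)); last first.
  have zero j : prob_joined G T p (v, false) (u, j) = 0.
    rewrite prob_joinedE -[RHS](expect_cst G p); apply: eq_expect => w _.
    case: (boolP (joined _ _ _)) => // /joined_percolatedV /= vuG.
    by case/negP: nG; apply: vuG; rewrite xpair_eqE negb_and vu.
  by rewrite !zero.
have TE j : prob_joined G (V G :&: T) p (v, false) (u, j) = prob_joined G T p (v, false) (u, j).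
  by rewrite !prob_joinedE; apply: eq_expect => w _; rewrite joined_percolatedI.
by rewrite -!TE; apply: holds; rewrite // subsetIl.
Qed.

Lemma joined_layer G T w a b : w \subset horizontal G -> [disjoint V G & T] ->
  joined (percolated G T w) a b -> a.2 = b.2.
Proof.
move=> wG dis ab.
have cl c d : adj (percolated G T w) c d -> c.2 == a.2 -> d.2 == a.2.
  rewrite adj_percolated // => /orP[/(subsetP wG)/horizontalP[e _ [i cd]]|].
    have : c \in lift_edge e i by rewrite -cd set21.
    have : d \in lift_edge e i by rewrite -cd set22.
    by case/imsetP => y _ ->; case/imsetP => z _ ->.
  by case/and4P => _ _ cG cT; rewrite (disjointFr dis cG) in cT.
by apply/esym/eqP; apply: (connect_closed (P := fun c => c.2 == a.2) cl ab).
Qed.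

(** As T lies in G1, the only post G2 can contain is the one at x. If x is in T, attaching it
    changes nothing; if not, G2 has no posts and cannot join x_0 to x_1. Hence the probabilities for
    G and G1 agree. *)
Lemma bunkbed_holds_side G x G1 G2 p : separation G x G1 G2 -> weights G p ->
  bunkbed_holds G p -> bunkbed_holds G1 p.
Proof.
move=> sep pG holds T T1 v u v1 u1.
have TE w : w \subset horizontal G2 -> attached_posts G2 x T w = T.
  move=> wG; rewrite /attached_posts; case: ifP => // xx.
  have [xT|xT] := boolP (x \in T); first by apply/setUidPr; rewrite sub1set.
  suff dis : [disjoint V G2 & T] by have := joined_layer wG dis xx.
  apply/pred0P => y /=; apply/negP => /andP[y2 yT].
  by rewrite -(separation_mem sep (subsetP T1 y yT) y2) yT in xT.
have sideE j : prob_joined G T p (v, false) (u, j) = prob_joined G1 T p (v, false) (u, j).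
  rewrite (prob_joined_side _ _ sep) // -[RHS](expect_cst G2 p).
  by apply: eq_expect => w /TE ->.
by rewrite /bunkbed_ineq -!sideE; apply: bunkbed_ineqW.
Qed.

(** Conversely, on one side the inequality is an average of inequalities for that side; across x the
    gap is a product of two nonnegative gaps. *)
Lemma bunkbed_holds_separation G x G1 G2 p : separation G x G1 G2 -> weights G p ->
  bunkbed_holds G p <-> bunkbed_holds G1 p /\ bunkbed_holds G2 p.
Proof.
move=> sep pG; split=> [holds|[holds1 holds2] T _ v u].
  by split; [apply: bunkbed_holds_side sep _ _|apply: bunkbed_holds_side (separationC sep) _ _].
have same_side G' G'' : separation G x G' G'' -> bunkbed_holds G' p ->
    v \in V G' -> u \in V G' -> bunkbed_ineq G T p v u.
  move=> sep' holds' v' u'; rewrite /bunkbed_ineq !(prob_joined_side _ _ sep') //.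
  apply: ler_expect => [|w _]; first exact: weights_separation (separationC sep') pG.
  by apply: bunkbed_ineqW => //; exact: weights_separation sep' pG.
have across G' G'' : separation G x G' G'' -> bunkbed_holds G' p -> bunkbed_holds G'' p ->
    v \notin V G'' -> u \in V G'' -> bunkbed_ineq G T p v u.
  move=> sep' holds' holds'' v' u'; rewrite /bunkbed_ineq -subr_ge0.
  rewrite (prob_joined_across _ _ sep') // mulr_ge0 // subr_ge0.
    by apply: bunkbed_ineqW => //; exact: weights_separation sep' pG.
  by apply: bunkbed_ineqW => //; exact: weights_separation (separationC sep') pG.
have [-> _ _] := sep; have sepC := separationC sep; rewrite !inE.
have [v1|v1] := boolP (v \in V G1); have [u1|u1] := boolP (u \in V G1) => /=.
- by move=> _ _; apply: same_side sep _ _ _.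
(* The vertex v may be the shared one, in which case both vertices lie in G2. *)
- have [v2 _ u2|v2 _ u2] := boolP (v \in V G2); first exact: same_side sepC _ _ _.
  exact: across sep _ _ _ _.
- by move=> _ _; apply: across sepC _ _ _ _.
- by move=> v2 u2; apply: same_side sepC _ _ _.
Qed.

(** Strong induction on the number of vertices. With at most one vertex there are no blocks and v
    equals u; a biconnected graph is its own only block. *)
Lemma bunkbed_holds_blocks G p : weights G p ->
  bunkbed_holds G p <-> (forall H, block G H -> bunkbed_holds H p).
Proof.
have [n] := ubnP #|V G|; elim: n => // n IH in G *; rewrite ltnS => Gn pG.
have [G_small|G_large] := leqP #|V G| 1.
  split=> [_ H [[H2 _ _] /andP[/subset_leq_card HG _] _]|_ T _ v u vG uG].
    by have := leq_trans H2 (leq_trans HG G_small).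
  by rewrite (card_le1_eqP G_small v u vG uG); apply: bunkbed_ineq_refl.
have [G_bicon|[x [G1 [G2 [sep G1n G2n]]]]] := biconnected_or_separation G_large.
  split=> [holds H [H_bicon HG maxH]|]; last first.
    by apply; split=> // [|K _ KG GK]; [exact: subgraph_refl|exact: subgraph_anti].
  by rewrite -(maxH G G_bicon (subgraph_refl G) HG).
have sepC := separationC sep.
rewrite (bunkbed_holds_separation sep pG).
rewrite (IH G1 (leq_trans G1n Gn) (weights_separation sep pG)).
rewrite (IH G2 (leq_trans G2n Gn) (weights_separation sepC pG)).
split=> [[holds1 holds2] H /(separation_block sep)[]|holds]; [exact: holds1|exact: holds2|].
by split=> H HG; apply: holds; [apply: block_separation sep HG|apply: block_separation sepC HG].
Qed.

Lemma eq_bunkbed_holds G p p' : {in E G, p =1 p'} -> bunkbed_holds G p -> bunkbed_holds G p'.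
Proof.
move=> pp' holds T TG v u vG uG.
have probE a b : prob_joined G T p' a b = prob_joined G T p a b.
  apply: eq_bigr => w _; apply: eq_bigr => e eG; apply: eq_bigr => i _.
  by rewrite pp'.
by rewrite /bunkbed_ineq !probE; apply: holds.
Qed.

End Expectation.

(** * The equivalence and its weak and strong forms *)

Theorem theorem1 (R : realType) (U : finType) (G : graph U) :
  (forall p : {set U} -> R, weights G p ->
     ((forall T : {set U}, T \subset V G ->
       forall v w : U, v \in V G -> w \in V G -> bunkbed_ineq G T p v w)
      <->
      (forall H : graph U, block G H ->
       forall T : {set U}, T \subset V H ->
       forall v w : U, v \in V H -> w \in V H -> bunkbed_ineq H T p v w)))
  /\ (weak_bunkbed R G <-> (forall H : graph U, block G H -> weak_bunkbed R H))
  /\ (strong_bunkbed R G <->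
      (forall H : graph U, block G H -> strong_bunkbed R H)).
Proof.
split; first exact: bunkbed_holds_blocks.
split; split=> [holds H GH p pH|holds p pG].
- by apply: (proj1 (bunkbed_holds_blocks _) (holds p pH)) => // e _.
- by apply/bunkbed_holds_blocks => // H GH; apply: holds.
- pose q e := if e \in E H then p e else 0%R.
  apply: (@eq_bunkbed_holds _ _ _ q) => [e eH|]; first by rewrite /q eH.
  have qG : weights G q.
    by move=> e _; rewrite /q; case: ifP => [/pH//|_]; rewrite lexx ler01.
  exact: (proj1 (bunkbed_holds_blocks qG) (holds q qG)).
- apply/bunkbed_holds_blocks => // H GH; apply: holds => // e eH.
  by apply: pG; have [_ /andP[_ /subsetP HG] _] := GH; apply: HG.
Qed.
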